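(* Fix a prime $p$. The space of all lineons (over $\mathbb F_p$), viewed as a subset of $[0,1]^{\mathcal F}$ with the product topology, is path-connected.
   Context: Let $\mathcal F$ be the countable set of all pairs $(m,f)$ with $m\ge1$ and $f:\mathbb F_p^m\setminus\{0^m\}\to\{0,1\}$. For $A\subseteq\mathbb F_p^n$ with $n\ge m$, let $p(f,A)$ be the probability that, for a uniformly random linear map $\bm\alpha:\mathbb F_p^m\to\mathbb F_p^n$, $(\mathbf 1_A\circ\bm\alpha)|_{\mathbb F_p^m\setminus\{0^m\}}=f$, where $\mathbf 1_A$ is the characteristic function of $A$; let $p(-,A)\in[0,1]^{\mathcal F}$ be the vector of these densities (with arbitrary values, say $0$, for $m>n$). A lineon is a point $\psi\in[0,1]^{\mathcal F}$ such that there exist $n_1<n_2<\cdots$ and sets $A_{n_t}\subseteq\mathbb F_p^{n_t}$ with $\lim_{t\to\infty}p((m,f),A_{n_t})=\psi((m,f))$ for every $(m,f)\in\mathcal F$. *)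

(* Defs.v *)
From HB Require Import structures.
From mathcomp Require Import all_boot all_order all_algebra.
From mathcomp Require Import all_classical all_reals all_analysis.

Set Implicit Arguments.
Unset Strict Implicit.
Unset Printing Implicit Defensive.

Import Order.TTheory GRing.Theory Num.Theory.
Import numFieldNormedType.Exports.

Local Open Scope classical_set_scope.
Local Open Scope ring_scope.

Definition path_connected (R : realType) (T : topologicalType) (X : set T) :=
  forall x y : T, X x -> X y ->
  exists gamma : R -> T,
    [/\ {within `[0, 1], continuous gamma},
        gamma 0 = x,
        gamma 1 = y &
        forall t : R, t \in `[0, 1] -> X (gamma t)].

Definition nzvec (p m : nat) := {v : 'rV['F_p]_m | v != 0}.

Definition pattern (p : nat) :=
  {mf : {m : nat & {ffun nzvec p m -> bool}} | (0 < tag mf)%N}.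

Definition pattern_dim p (F : pattern p) : nat := tag (val F).

Definition pattern_fun p (F : pattern p) :
  {ffun nzvec p (pattern_dim F) -> bool} := tagged (val F).

(* A linear map 'F_p^m -> 'F_p^n is encoded by its matrix M acting on row
   vectors by v |-> v *m M, so a uniformly random linear map is a uniformly
   random m x n matrix. *)
Definition density (R : realType) (p n : nat) (F : pattern p)
    (A : {set 'rV['F_p]_n}) : R :=
  if (pattern_dim F <= n)%N then
    #|[set M : 'M['F_p]_(pattern_dim F, n) |
        [forall v : nzvec p (pattern_dim F),
          (val v *m M \in A) == pattern_fun F v]]%SET|%:R
    / #|{: 'M['F_p]_(pattern_dim F, n)}|%:R
  else 0.

Definition lineon (R : realType) (p : nat) : set {ptws pattern p -> R} :=
  [set psi | (forall F, (psi F : R) \in `[0, 1]) /\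
    exists (n : nat -> nat) (A : forall t, {set 'rV['F_p]_(n t)}),
      {homo n : s t / (s < t)%N} /\
      forall F : pattern p,
        (fun t => density R F (A t)) @ \oo --> (psi F : R)].

Arguments lineon R p : clear implicits.

(* Main.v *)
(** Given lineons [psi] and [phi], limits of [A_s] and [B_s], consider the sets
    of triples [(z, x, y)] such that [x \in A_s] if [z \in D_t], and
    [y \in B_s] otherwise, where [D_t] is the set of those [z] in ['F_p^s] whose
    base-[p] value is less than the integer part of [t * p ^ s].  The three
    coordinates of a random linear map are independent, so the densities of
    these sets are multilinear in those of [D_t], [A_s] and [B_s].  A random
    linear map sends a nonzero vector to a uniform one, so by the union bound
    sets that differ in few points have close densities; hence the densities of
    [D_t] converge as [s] grows, and their limit is Lipschitz in [t].  At
    [t = 0] and [t = 1], [D_t] is empty, respectively full, so the resulting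
    path of lineons joins [phi] to [psi]. *)

Require Import Defs.
From mathcomp Require Import all_boot all_order all_algebra.
From mathcomp Require Import all_classical all_reals all_analysis.
From mathcomp Require Import zify lra.
Import numFieldNormedType.Exports.

Set Implicit Arguments.
Unset Strict Implicit.
Unset Printing Implicit Defensive.

Import Order.TTheory GRing.Theory Num.Theory.

Local Open Scope classical_set_scope.
Local Open Scope ring_scope.

Lemma sum_delta (R : pzSemiRingType) (I : finType) (i : I) (F : I -> R) :
  \sum_j (j == i)%:R * F j = F i.
Proof.
rewrite (bigD1 i)//= eqxx mul1r big1 ?addr0// => j /negPf ->.
by rewrite mul0r.
Qed.

Section Truncation.
Variable R : archiRealDomainType.
Implicit Types x y : R.

Lemma truncn_lt0 x : x < 0 -> Num.truncn x = 0%N.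
Proof. by move=> x0; apply/truncn0Pn; rewrite -ltNge (lt_trans x0). Qed.

Lemma dist_truncn x y :
  `|(Num.truncn x)%:R - (Num.truncn y)%:R| <= `|x - y| + 1 :> R.
Proof.
wlog xy : x y / x <= y => [wlog_xy|].
  have /orP[|yx] := le_total x y; first exact: wlog_xy.
  by rewrite distrC [`|x - y|]distrC wlog_xy.
rewrite distrC ger0_norm ?subr_ge0 ?ler_nat ?le_truncn//.
rewrite distrC ger0_norm ?subr_ge0//; have := truncnS_gt x; rewrite -natr1.
have [y0|y0] := leP 0 y; last by rewrite !truncn_lt0//; lra.
by have /andP[] := truncn_itv y0; lra.
Qed.

Lemma dist_truncnM (n : nat) x :
  `|(Num.truncn (n%:R * x))%:R - (n * Num.truncn x)%:R| <= n%:R :> R.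
Proof.
have [->|n0] := posnP n; first by rewrite mul0r truncn0 subrr normr0.
have [x0|x0] := leP 0 x; last first.
  by rewrite !truncn_lt0 ?muln0 ?subrr ?normr0// pmulr_rlt0 ?ltr0n.
have /andP[xl xu] := truncn_itv x0.
have le_l : (n * Num.truncn x <= Num.truncn (n%:R * x))%N.
  by rewrite truncn_ge_nat ?mulr_ge0// natrM ler_wpM2l.
have le_u : (Num.truncn (n%:R * x) < n * (Num.truncn x).+1)%N.
  by rewrite truncn_lt_nat ?mulr_ge0// natrM ltr_pM2l ?ltr0n.
by rewrite -natrB// normr_nat ler_nat leq_subLR -mulnSr ltnW.
Qed.

End Truncation.

Lemma is_cvg_geometric_increments (R : realType) (V : completeNormedModType R)
    (u : V ^nat) (C r : R) :
  `|r| < 1 -> (forall n, `|u n.+1 - u n| <= C * r ^+ n) -> cvgn u.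
Proof.
move=> r1 u_le.
rewrite (_ : u = fun n => u 0%N + series (telescope u) n); last first.
  by apply/funext => n; rewrite -eq_sum_telescope.
apply: is_cvgD; first exact: is_cvg_cst.
apply/normed_cvg/(series_le_cvg _ _ u_le) => [n|n|] /=; first exact: normr_ge0.
  exact: le_trans (u_le n).
exact: is_cvg_geometric_series.
Qed.

Lemma klipschitz_continuous (R : realFieldType) (V W : normedModType R) (k : R)
    (f : V -> W) : k.-lipschitz f -> continuous f.
Proof.
move=> f_lip x; apply/cvgrPdist_le => e e0.
have k1 : 0 < `|k| + 1 by rewrite ltr_wpDl.
near=> y; apply: (@le_trans _ _ ((`|k| + 1) * `|x - y|)).
  apply: le_trans (f_lip (x, y) _) _ => //=.
  by rewrite ler_wpM2r//; apply: le_trans (ler_norm k) _; rewrite lerDl.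
rewrite -ler_pdivlMl// mulrC; near: y.
by apply: cvgr_dist_le => //; rewrite divr_gt0.
Unshelve. all: by end_near. Qed.

Lemma continuous_prod_topology (X : topologicalType) (I : Type)
    (K : I -> topologicalType) (f : X -> prod_topology K) :
  (forall i, continuous (fun x => f x i)) -> continuous f.
Proof.
move=> cf x; apply/cvg_sup => i.
pose proj_i (g : forall i, K i) := g i.
exact: (@continuous_comp_initial _ X (K i) proj_i f (cf i)).
Qed.

Lemma homo_ltn_cvg_infty (n : nat -> nat) :
  {homo n : s t / (s < t)%N} -> n @ \oo --> \oo.
Proof.
move=> n_incr; apply/cvgnyPge => m; near=> s.
apply: (@leq_trans s); last exact: unstable.mono_leq_infl (leq_mono n_incr) s.
by near: s; exact: nbhs_infty_ge.
Unshelve. all: by end_near. Qed.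

Definition symdiff (T : finType) (A B : {set T}) : {set T} :=
  [set x | (x \in A) (+) (x \in B)]%SET.

Section Average.
Variable R : numFieldType.

Definition average (T : finType) (phi : T -> R) : R :=
  (\sum_x phi x) / #|T|%:R.

Lemma eq_average (T : finType) (phi psi : T -> R) :
  phi =1 psi -> average phi = average psi.
Proof. by move=> eq_phi; congr (_ / _); exact: eq_bigr. Qed.

Lemma average_cst (T : finType) (c : R) :
  (0 < #|T|)%N -> average (fun _ : T => c) = c.
Proof.
move=> T_gt0; rewrite /average sumr_const -[_ *+ _]mulr_natr mulfK//.
by rewrite pnatr_eq0 -lt0n.
Qed.

Lemma average_mem (T : finType) (A : {set T}) :
  average (fun x => (x \in A)%:R) = #|A|%:R / #|T|%:R.
Proof.
rewrite -[#|A|]sum1_card natr_sum [in RHS]big_mkcond; congr (_ / _).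
by apply: eq_bigr => x _; rewrite mulrb.
Qed.

Lemma averageB (T : finType) (phi psi : T -> R) :
  average (fun x => phi x - psi x) = average phi - average psi.
Proof. by rewrite /average sumrB mulrBl. Qed.

Lemma averageZr (T : finType) (phi : T -> R) (c : R) :
  average (fun x => phi x * c) = average phi * c.
Proof. by rewrite /average -mulr_suml mulrAC. Qed.

Lemma average_sum (T I : finType) (phi : I -> T -> R) :
  average (fun x => \sum_i phi i x) = \sum_i average (phi i).
Proof. by rewrite /average exchange_big mulr_suml. Qed.

Lemma ler_average (T : finType) (phi psi : T -> R) :
  (forall x, phi x <= psi x) -> average phi <= average psi.
Proof. by move=> le_phi; rewrite ler_wpM2r ?invr_ge0// ler_sum. Qed.

Lemma ler_norm_average (T : finType) (phi : T -> R) :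
  `|average phi| <= average (fun x => `|phi x|).
Proof.
by rewrite normrM normfV normr_nat ler_wpM2r ?invr_ge0// ler_norm_sum.
Qed.

Lemma average_bij (T U : finType) (f : T -> U) (phi : U -> R) :
  bijective f -> average (phi \o f) = average phi.
Proof.
move=> f_bij; rewrite /average (bij_eq_card f_bij) [in RHS](reindex f)//.
exact: onW_bij.
Qed.

Lemma average_pair (T U : finType) (phi : T * U -> R) :
  average phi = average (fun x => average (fun y => phi (x, y))).
Proof.
rewrite /average -mulr_suml pair_big card_prod natrM invfM mulrA mulrAC.
by congr (_ / _ / _); apply: eq_bigr => -[].
Qed.

Lemma exchange_average (T U : finType) (phi : T -> U -> R) :
  average (fun x => average (phi x)) = average (fun y => average (phi^~ y)).
Proof. by rewrite /average -!mulr_suml exchange_big mulrAC. Qed.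

(* Replacing [x] by [x + s y] for a uniformly random [y] does not change the
   average, but turns [f x] into the uniformly distributed [f x + y]. *)
Lemma average_comp_additive (G H : finZmodType) (f : {additive G -> H})
    (s : H -> G) (phi : H -> R) :
  cancel s f -> average (phi \o f) = average phi.
Proof.
move=> sK.
have card_gt0 (K : finZmodType) : (0 < #|K|)%N by apply/card_gt0P; exists 0.
transitivity (average (fun y => average (fun x => phi (f x + y)))).
  rewrite -[LHS](@average_cst H)//; apply: eq_average => y.
  rewrite -(average_bij (phi \o f) (f := fun x => x + s y)).
    by apply: eq_average => x /=; rewrite raddfD sK.
  by exists (fun x => x - s y); [exact: addrK | exact: subrK].
rewrite exchange_average -[RHS](@average_cst G)//; apply: eq_average => x.
apply: (average_bij phi (f := fun y => f x + y)).
by exists (+%R (- f x)); [exact: addKr | exact: addNKr].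
Qed.

Lemma average_row_mx (K : finType) m n1 n2 (phi : 'M[K]_(m, n1 + n2) -> R) :
  average phi = average (fun M1 => average (fun M2 => phi (row_mx M1 M2))).
Proof.
rewrite -(average_pair (fun x => phi (row_mx x.1 x.2))).
rewrite -(average_bij phi (f := fun x => row_mx x.1 x.2))//.
by exists (fun M => (lsubmx M, rsubmx M)) => [[M1 M2]|M] /=;
  rewrite ?row_mxKl ?row_mxKr ?hsubmxK.
Qed.

Lemma average_mulmx (K : finFieldType) m n (v : 'rV[K]_m)
    (phi : 'rV[K]_n -> R) :
  v != 0 -> average (fun M : 'M[K]_(m, n) => phi (v *m M)) = average phi.
Proof.
move=> v0.
apply: (@average_comp_additive _ _ (mulmx v) (mulmx (pinvmx v))) => y.
by rewrite /= mulmxA mulmxVp ?mul1mx// /row_free rank_rV v0.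
Qed.

End Average.

Section Mixture.
Variable T : finType.
Implicit Types f g h : {ffun T -> bool}.

Definition mix_fun h g g' : {ffun T -> bool} :=
  [ffun v => if h v then g v else g' v].

(* The law of [mix_fun h g g'] for independent [h], [g] and [g'] with laws [d],
   [a] and [b]. *)
Definition mixture (R : pzSemiRingType) (d a b : {ffun T -> bool} -> R) f : R :=
  \sum_h d h * \sum_g a g * \sum_g' b g' * (mix_fun h g g' == f)%:R.

Lemma mixture_true (R : pzSemiRingType) (a b : {ffun T -> bool} -> R) :
  \sum_g b g = 1 -> mixture (fun h => (h == [ffun=> true])%:R) a b =1 a.
Proof.
move=> b1 f; rewrite /mixture sum_delta.
rewrite (eq_bigr (fun g => (g == f)%:R * a g)) ?sum_delta// => g _.
have -> : mix_fun [ffun=> true] g = fun=> g.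
  by apply/funext => g'; apply/ffunP => v; rewrite !ffunE.
by rewrite -mulr_suml b1 mul1r mulr_natr mulr_natl.
Qed.

Lemma mixture_false (R : pzSemiRingType) (a b : {ffun T -> bool} -> R) :
  \sum_g a g = 1 -> mixture (fun h => (h == [ffun=> false])%:R) a b =1 b.
Proof.
move=> a1 f; rewrite /mixture sum_delta.
rewrite (eq_bigr (fun g => a g * b f)) => [|g _].
  by rewrite -mulr_suml a1 mul1r.
rewrite (eq_bigr (fun g' => (g' == f)%:R * b g')) ?sum_delta// => g' _.
have -> : mix_fun [ffun=> false] g g' = g' by apply/ffunP => v; rewrite !ffunE.
by rewrite mulr_natr mulr_natl.
Qed.

Lemma cvg_mixture (R : numFieldType) (X : Type) (F : set_system X)
    (d a b : X -> {ffun T -> bool} -> R) (d' a' b' : {ffun T -> bool} -> R) f :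
  Filter F ->
  (forall h, d^~ h @ F --> d' h) -> (forall g, a^~ g @ F --> a' g) ->
  (forall g, b^~ g @ F --> b' g) ->
  (fun x => mixture (d x) (a x) (b x) f) @ F --> mixture d' a' b' f.
Proof.
move=> FF cvg_d cvg_a cvg_b.
apply: cvg_big => [|h _]; first exact: add_continuous.
apply: cvgM => //; apply: cvg_big => [|g _]; first exact: add_continuous.
apply: cvgM => //; apply: cvg_big => [|g' _]; first exact: add_continuous.
exact: cvgMl.
Qed.

End Mixture.

Local Notation nzpred p m := {ffun nzvec p m -> bool}.

Section Frequencies.
Variables (R : numFieldType) (p : nat).

Definition profile m n (A : {set 'rV['F_p]_n}) (M : 'M['F_p]_(m, n)) :
  nzpred p m := [ffun v => val v *m M \in A].

Definition freq m n (A : {set 'rV['F_p]_n}) (f : nzpred p m) : R :=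
  average (fun M : 'M['F_p]_(m, n) => (profile A M == f)%:R).

Lemma card_mx_gt0 m n : (0 < #|{: 'M['F_p]_(m, n)}|)%N.
Proof. by apply/card_gt0P; exists 0. Qed.

Lemma average_profile m n (A : {set 'rV['F_p]_n})
    (phi : nzpred p m -> R) :
  average (fun M : 'M['F_p]_(m, n) => phi (profile A M)) =
  \sum_f freq A f * phi f.
Proof.
under [RHS]eq_bigr do rewrite -averageZr.
rewrite -average_sum; apply: eq_average => M.
by under eq_bigr do rewrite eq_sym; rewrite sum_delta.
Qed.

Lemma sum_freq m n (A : {set 'rV['F_p]_n}) :
  \sum_(f : nzpred p m) freq A f = 1.
Proof.
under eq_bigr do rewrite -[freq _ _]mulr1.
by rewrite -(average_profile A (fun=> 1)) average_cst ?card_mx_gt0.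
Qed.

Lemma freq_ge0 m n (A : {set 'rV['F_p]_n}) (f : nzpred p m) :
  0 <= freq A f.
Proof. by rewrite divr_ge0 ?sumr_ge0. Qed.

Lemma freq_le1 m n (A : {set 'rV['F_p]_n}) (f : nzpred p m) :
  freq A f <= 1.
Proof.
rewrite -(sum_freq m A) (bigD1 f)//= lerDl sumr_ge0// => g _.
exact: freq_ge0.
Qed.

Lemma freq_cst_profile m n (A : {set 'rV['F_p]_n})
    (f g : nzpred p m) :
  (forall M, profile A M = g) -> freq A f = (f == g)%:R.
Proof.
move=> Ag; rewrite -[RHS](@average_cst _ 'M['F_p]_(m, n)) ?card_mx_gt0//.
by apply: eq_average => M; rewrite Ag eq_sym.
Qed.

Lemma freq_set0 m n (f : nzpred p m) :
  freq (finset.set0 : {set 'rV['F_p]_n}) f = (f == [ffun=> false])%:R.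
Proof.
by apply: freq_cst_profile => M; apply/ffunP => v; rewrite !ffunE inE.
Qed.

Lemma freq_setT m n (f : nzpred p m) :
  freq [set: 'rV['F_p]_n]%SET f = (f == [ffun=> true])%:R.
Proof.
by apply: freq_cst_profile => M; apply/ffunP => v; rewrite !ffunE inE.
Qed.

Definition cylinder k n (A : {set 'rV['F_p]_n}) : {set 'rV['F_p]_(k + n)} :=
  [set x | rsubmx x \in A]%SET.

Lemma freq_cylinder m k n (A : {set 'rV['F_p]_n}) (f : nzpred p m) :
  freq (cylinder k A) f = freq A f.
Proof.
rewrite /freq -(average_comp_additive (f := @rsubmx _ m k n) _ (row_mxKr 0)).
apply: eq_average => M /=; congr (_ == _)%:R.
by apply/ffunP => v; rewrite !ffunE inE mulmx_rsub.
Qed.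

Definition mix_set k n1 n2 (D : {set 'rV['F_p]_k}) (A : {set 'rV['F_p]_n1})
    (B : {set 'rV['F_p]_n2}) : {set 'rV['F_p]_(k + (n1 + n2))} :=
  [set x | if lsubmx x \in D then lsubmx (rsubmx x) \in A
           else rsubmx (rsubmx x) \in B]%SET.

Lemma profile_mix_set m k n1 n2 (D : {set 'rV['F_p]_k}) (A : {set 'rV['F_p]_n1})
    (B : {set 'rV['F_p]_n2}) (L : 'M['F_p]_(m, k)) (M : 'M['F_p]_(m, n1))
    (N : 'M['F_p]_(m, n2)) :
  profile (mix_set D A B) (row_mx L (row_mx M N)) =
  mix_fun (profile D L) (profile A M) (profile B N).
Proof.
by apply/ffunP => v; rewrite !ffunE !inE !mul_mx_row !(row_mxKl, row_mxKr).
Qed.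

Lemma freq_mix_set m k n1 n2 (D : {set 'rV['F_p]_k}) (A : {set 'rV['F_p]_n1})
    (B : {set 'rV['F_p]_n2}) (f : nzpred p m) :
  freq (mix_set D A B) f = mixture (freq D) (freq A) (freq B) f.
Proof.
rewrite /mixture -average_profile [LHS]average_row_mx; apply: eq_average => L.
rewrite -average_profile average_row_mx; apply: eq_average => M.
rewrite -average_profile; apply: eq_average => N.
by rewrite profile_mix_set.
Qed.

(* Union bound: a nonzero vector is mapped to a uniformly distributed vector. *)
Lemma dist_freq m n (A B : {set 'rV['F_p]_n}) (f : nzpred p m) :
  `|freq A f - freq B f| <=
  #|{: nzvec p m}|%:R * (#|symdiff A B|%:R / #|{: 'rV['F_p]_n}|%:R).
Proof.
rewrite -averageB; apply: le_trans (ler_norm_average _) _.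
have -> : #|{: nzvec p m}|%:R * (#|symdiff A B|%:R / #|{: 'rV['F_p]_n}|%:R) =
    average (fun M : 'M['F_p]_(m, n) =>
      \sum_(v : nzvec p m) (val v *m M \in symdiff A B)%:R) :> R.
  rewrite average_sum mulr_natl -sumr_const -average_mem; apply: eq_bigr => v _.
  by rewrite (average_mulmx (fun y => (y \in symdiff A B)%:R)) ?(valP v).
apply: ler_average => M; have [->|] := eqVneq (profile A M) (profile B M).
  by rewrite subrr normr0 sumr_ge0.
move=> neq; have [v vAB] : exists v : nzvec p m, val v *m M \in symdiff A B.
  apply/existsP; apply: contraNT neq => /existsPn eqAB.
  apply/eqP/ffunP => v; rewrite !ffunE; apply/eqP.
  by have := eqAB v; rewrite inE -negb_eqb negbK.
rewrite (bigD1 v)//= vAB (@le_trans _ _ 1) ?lerDl ?sumr_ge0//.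
by case: (_ == f); case: (_ == f);
  rewrite ?subrr ?normr0 ?subr0 ?sub0r ?normrN ?normr1.
Qed.

End Frequencies.

Section Segments.
Variables (p : nat) (p_prime : prime p).

Lemma ltn_Fp (a : 'F_p) : (a < p)%N.
Proof. by rewrite -[X in (_ < X)%N](Fp_cast p_prime). Qed.

Definition base_value k (y : 'rV['F_p]_k) : nat :=
  (\sum_(i < k) y 0%R i * p ^ i)%N.

Lemma base_value_row k (y : 'rV['F_p]_(1 + k)) :
  base_value y = (lsubmx y 0%R 0%R + p * base_value (rsubmx y))%N.
Proof.
rewrite /base_value big_split_ord big_ord1 /= expn0 muln1 mxE; congr (_ + _)%N.
by rewrite big_distrr; apply: eq_bigr => i _; rewrite mxE expnS mulnCA.
Qed.

Lemma base_value_lt k (y : 'rV['F_p]_k) : (base_value y < p ^ k)%N.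
Proof.
move: y; elim: k => [y|k IHk]; first by rewrite /base_value big_ord0.
rewrite -(add1n k) => y; rewrite base_value_row expnS.
have := IHk (rsubmx y); have := ltn_Fp (lsubmx y 0 0).
by set a := nat_of_ord _; set b := base_value _; nia.
Qed.

Lemma base_value_inj k : injective (@base_value k).
Proof.
elim: k => [y z _|k IHk]; first by apply/rowP => - [].
rewrite -(add1n k) => y z; rewrite !base_value_row => eq_yz.
have eq_digit : lsubmx y 0 0 = lsubmx z 0 0.
  have := congr1 (modn^~ p) eq_yz.
  rewrite ![(_ + p * _)%N]addnC ![(p * _)%N]mulnC.
  by rewrite !modnMDl !modn_small ?ltn_Fp// => /val_inj.
have eq_l : lsubmx y = lsubmx z by apply/matrixP => i j; rewrite !ord1.
have eq_r : rsubmx y = rsubmx z.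
  apply: IHk; move: eq_yz; rewrite eq_digit => /addnI/eqP.
  by rewrite eqn_pmul2l ?prime_gt0// => /eqP.
by rewrite -[y]hsubmxK eq_l eq_r hsubmxK.
Qed.

Definition segment k j : {set 'rV['F_p]_k} :=
  [set y | (base_value y < j)%N]%SET.

Lemma segment0 k : segment k 0 = finset.set0.
Proof. by apply/setP => y; rewrite !inE. Qed.

Lemma segment_full k : segment k (p ^ k) = [set: 'rV_k]%SET.
Proof. by apply/setP => y; rewrite !inE base_value_lt. Qed.

Lemma segment_cylinder k j : segment (1 + k) (p * j) = cylinder 1 (segment k j).
Proof.
apply/setP => y; rewrite !inE base_value_row; have := ltn_Fp (lsubmx y 0 0).
by set a := nat_of_ord _; set b := base_value _ => a_lt; apply/idP/idP; nia.
Qed.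

Lemma card_symdiff_segment (R : numDomainType) k i j :
  #|symdiff (segment k i) (segment k j)|%:R <= `|i%:R - j%:R| :> R.
Proof.
wlog ij : i j / (i <= j)%N => [wlog_ij|].
  have /orP[|ji] := leq_total i j; first exact: wlog_ij.
  rewrite distrC; apply: le_trans (wlog_ij _ _ ji); rewrite ler_nat.
  by apply/subset_leq_card/fintype.subsetP => y; rewrite !inE addbC.
rewrite distrC -natrB// normr_nat ler_nat.
rewrite cardE -(size_map (@base_value k)) -[leqRHS](size_iota i).
apply: uniq_leq_size.
  by rewrite map_inj_uniq ?enum_uniq//; exact: base_value_inj.
move=> _ /mapP[y + ->]; rewrite mem_enum !inE mem_iota subnKC//.
by case: ltnP => yi; case: ltnP => yj //= _; lia.
Qed.

Lemma dist_freq_segment (R : numFieldType) m k i j (f : nzpred p m) :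
  `|freq R (segment k i) f - freq R (segment k j) f| <=
  #|{: nzvec p m}|%:R * (`|i%:R - j%:R| / p%:R ^+ k).
Proof.
apply: le_trans (dist_freq _ _ _ _) _; rewrite ler_wpM2l//.
rewrite card_mx card_Fp// mul1n natrX.
by rewrite ler_wpM2r ?card_symdiff_segment ?invr_ge0 ?exprn_ge0.
Qed.

End Segments.

Section SegmentLimit.
Variables (R : realType) (p : nat) (p_prime : prime p).
Implicit Types s t : R.

Definition fraction_segment t k : {set 'rV['F_p]_k} :=
  segment p k (Num.truncn (t * p%:R ^+ k)).

Definition lim_segment_freq m t (f : nzpred p m) : R :=
  limn (fun k => freq R (fraction_segment t k) f).

Let p_gt0 : 0 < p%:R :> R. Proof. by rewrite ltr0n prime_gt0. Qed.

Let normr_pV_lt1 : `|p%:R^-1 : R| < 1.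
Proof. by rewrite normfV normr_nat invf_lt1// ltr1n prime_gt1. Qed.

Lemma dist_freq_fraction_segmentS m t k (f : nzpred p m) :
  `|freq R (fraction_segment t k.+1) f - freq R (fraction_segment t k) f| <=
  #|{: nzvec p m}|%:R * p%:R^-1 ^+ k.
Proof.
rewrite /fraction_segment -(freq_cylinder _ 1 (segment p k _)).
rewrite -segment_cylinder//.
apply: le_trans (dist_freq_segment p_prime _ _ _ _ _) _; rewrite ler_wpM2l//.
rewrite ler_pdivrMr ?exprn_gt0// exprS [leRHS]mulrCA.
rewrite -exprMn mulVf ?gt_eqF// expr1n mulr1.
by rewrite [t * _]mulrCA dist_truncnM.
Qed.

Lemma cvg_freq_fraction_segment m t (f : nzpred p m) :
  freq R (fraction_segment t k) f @[k --> \oo] --> lim_segment_freq t f.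
Proof.
apply: (is_cvg_geometric_increments normr_pV_lt1) => k.
exact: dist_freq_fraction_segmentS.
Qed.

Lemma dist_freq_fraction_segment m s t k (f : nzpred p m) :
  `|freq R (fraction_segment s k) f - freq R (fraction_segment t k) f| <=
  #|{: nzvec p m}|%:R * (`|s - t| + p%:R^-1 ^+ k).
Proof.
have pk : 0 < p%:R ^+ k :> R by rewrite exprn_gt0.
apply: le_trans (dist_freq_segment p_prime _ _ _ _ _) _; rewrite ler_wpM2l//.
rewrite ler_pdivrMr// mulrDl exprVn mulVf ?gt_eqF//.
by rewrite -[in leRHS](gtr0_norm pk) -normrM mulrBl dist_truncn.
Qed.

Lemma lim_segment_freq_lipschitz m (f : nzpred p m) :
  (#|{: nzvec p m}|%:R).-lipschitz (fun t => lim_segment_freq t f).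
Proof.
move=> [s t] _ /=.
have cvg_diff :
    `|freq R (fraction_segment s k) f - freq R (fraction_segment t k) f|
      @[k --> \oo] --> `|lim_segment_freq s f - lim_segment_freq t f|.
  by apply: cvg_norm; apply: cvgB; exact: cvg_freq_fraction_segment.
have cvg_bound :
    #|{: nzvec p m}|%:R * (`|s - t| + p%:R^-1 ^+ k) @[k --> \oo] -->
    #|{: nzvec p m}|%:R * `|s - t|.
  apply: cvgMr; rewrite -[X in _ --> X]addr0; apply: cvgD; first exact: cvg_cst.
  exact: cvg_expr.
apply: (ler_cvg_to cvg_diff cvg_bound); near=> k.
exact: dist_freq_fraction_segment.
Unshelve. all: by end_near. Qed.

Lemma lim_segment_freq0 m :
  lim_segment_freq 0 = fun f : nzpred p m => (f == [ffun=> false])%:R.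
Proof.
apply/funext => f; apply: cvg_lim => //; apply: cvg_near_cst; near=> k.
by rewrite /fraction_segment mul0r truncn0 segment0 freq_set0.
Unshelve. all: by end_near. Qed.

Lemma lim_segment_freq1 m :
  lim_segment_freq 1 = fun f : nzpred p m => (f == [ffun=> true])%:R.
Proof.
apply/funext => f; apply: cvg_lim => //; apply: cvg_near_cst; near=> k.
by rewrite /fraction_segment mul1r -natrX natrK segment_full// freq_setT.
Unshelve. all: by end_near. Qed.

End SegmentLimit.

Definition with_fun p (F : pattern p) (g : nzpred p (pattern_dim F)) :
  pattern p := exist _ (existT _ (pattern_dim F) g) (svalP F).

Definition slice (R : Type) p (psi : pattern p -> R) (F : pattern p)
    (g : nzpred p (pattern_dim F)) : R := psi (with_fun g).

Arguments slice {R p} psi F g.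

Lemma slice_pattern_fun (R : Type) p (psi : pattern p -> R) (F : pattern p) :
  slice psi F (pattern_fun F) = psi F.
Proof. by congr psi; apply: val_inj; case: F => -[m f] m0. Qed.

Section Lineons.
Variables (R : realType) (p : nat).

Lemma density_freq n (F : pattern p) (A : {set 'rV['F_p]_n}) :
  (pattern_dim F <= n)%N -> density R F A = freq R A (pattern_fun F).
Proof.
rewrite /density => ->; rewrite -average_mem; apply: eq_average => M.
rewrite inE; congr (nat_of_bool _)%:R.
apply/forallP/eqP => [eqM|<- v]; last by rewrite ffunE.
by apply/ffunP => v; rewrite ffunE; exact/eqP.
Qed.

Lemma cvg_density_freq (n : nat -> nat) (A : forall s, {set 'rV['F_p]_(n s)})
    (F : pattern p) (l : R) :
  {homo n : s t / (s < t)%N} ->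
  density R F (A s) @[s --> \oo] --> l <->
  freq R (A s) (pattern_fun F) @[s --> \oo] --> l.
Proof.
move=> n_incr.
have eq_freq : \forall s \near \oo,
    density R F (A s) = freq R (A s) (pattern_fun F).
  near=> s; apply: density_freq; near: s.
  exact: (cvgnyPge _).1 (homo_ltn_cvg_infty n_incr) _.
by split; apply: cvg_trans; apply: near_eq_cvg => //;
  apply: filterS eq_freq => s ->.
Unshelve. all: by end_near. Qed.

Lemma lineonP (psi : {ptws pattern p -> R}) :
  lineon R p psi <->
  exists (n : nat -> nat) (A : forall s, {set 'rV['F_p]_(n s)}),
    {homo n : s t / (s < t)%N} /\
    forall F, freq R (A s) (pattern_fun F) @[s --> \oo] --> psi F.
Proof.
split=> [[_ [n [A [n_incr cvgA]]]]|[n [A [n_incr cvgA]]]].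
  by exists n, A; split=> // F; apply/cvg_density_freq.
split=> [F|]; last by exists n, A; split=> // F; apply/cvg_density_freq.
rewrite in_itv/=; apply/andP; split.
  by apply: (cvgr_to_ge (cvgA F)); apply: nearW => s; exact: freq_ge0.
by apply: (cvgr_to_le (cvgA F)); apply: nearW => s; exact: freq_le1.
Qed.

Lemma sum_slice (psi : {ptws pattern p -> R}) (F : pattern p) :
  lineon R p psi -> \sum_g slice psi F g = 1.
Proof.
move=> /lineonP[n [A [_ cvgA]]].
have cvg_sum : \sum_(g : nzpred p (pattern_dim F))
    freq R (A s) g @[s --> \oo] --> \sum_g slice psi F g.
  apply: cvg_big => [|g _]; first exact: add_continuous.
  exact: (cvgA (with_fun g)).
rewrite -(cvg_lim _ cvg_sum)//; under eq_fun do rewrite sum_freq.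
exact: lim_cst.
Qed.

End Lineons.

Section MixPath.
Variables (R : realType) (p : nat) (p_prime : prime p).

Definition mix_path (psi phi : pattern p -> R) (t : R) :
    {ptws pattern p -> R} :=
  fun F => mixture (lim_segment_freq t) (slice psi F) (slice phi F)
    (pattern_fun F).

Lemma continuous_mix_path (psi phi : pattern p -> R) :
  continuous (mix_path psi phi).
Proof.
apply: continuous_prod_topology => F t; apply: cvg_mixture => g.
- exact: klipschitz_continuous (lim_segment_freq_lipschitz p_prime g) t.
- exact: cvg_cst.
- exact: cvg_cst.
Qed.

Lemma mix_path0 (psi phi : {ptws pattern p -> R}) :
  lineon R p psi -> mix_path psi phi 0 = phi.
Proof.
move=> psi_lineon; apply/funext => F.
rewrite /mix_path lim_segment_freq0 mixture_false ?sum_slice//.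
exact: slice_pattern_fun.
Qed.

Lemma mix_path1 (psi phi : {ptws pattern p -> R}) :
  lineon R p phi -> mix_path psi phi 1 = psi.
Proof.
move=> phi_lineon; apply/funext => F.
rewrite /mix_path lim_segment_freq1// mixture_true ?sum_slice//.
exact: slice_pattern_fun.
Qed.

Lemma lineon_mix_path (psi phi : {ptws pattern p -> R}) (t : R) :
  lineon R p psi -> lineon R p phi -> lineon R p (mix_path psi phi t).
Proof.
move=> /lineonP[n [A [n_incr cvgA]]] /lineonP[n' [B [n'_incr cvgB]]].
apply/lineonP; exists (fun s => s + (n s + n' s))%N.
exists (fun s => mix_set (fraction_segment p t s) (A s) (B s)).
split=> [i j ij|F].
  by have := n_incr _ _ ij; have := n'_incr _ _ ij; lia.
under eq_fun do rewrite freq_mix_set.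
apply: cvg_mixture => g; [exact: cvg_freq_fraction_segment | |].
- exact: (cvgA (with_fun g)).
- exact: (cvgB (with_fun g)).
Qed.

End MixPath.

Theorem theorem7p17 (R : realType) (p : nat) (p_prime : prime p) :
  path_connected R (lineon R p : set {ptws pattern p -> R}).
Proof.
move=> phi psi phi_lineon psi_lineon; exists (mix_path psi phi); split.
- by apply: continuous_subspaceT; exact: continuous_mix_path.
- exact: mix_path0.
- exact: mix_path1.
- by move=> t _; exact: lineon_mix_path.
Qed.
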